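(* Let $(\mathcal{P},\mathrm{ar},[\![\cdot]\!])$ be a numerical predicate collection and $\sigma$ a relational signature. Every $\mathrm{FOCN}(\mathcal{P})[\sigma]$-formula $\varphi(\bar x)$ without free number variables is Hanf-local, with Hanf-locality rank $\mathrm{lr}(\varphi)<(2\,\mathrm{bw}(\varphi)+1)^{\mathrm{br}(\varphi)}$.
   Context: Structures are finite with non-empty universe; a relational signature is a finite set of relation symbols with arities. A numerical predicate collection is a countable set $\mathcal{P}$ of predicate names with arities $\mathrm{ar}(\mathsf{P})\ge1$ and semantics $[\![\mathsf{P}]\!]\subseteq\mathbb{Z}^{\mathrm{ar}(\mathsf{P})}$. Logic $\mathrm{FOCN}(\mathcal{P})[\sigma]$: structure variables range over the universe, number variables over integers. Formulas and counting terms are built by: atomic formulas $x_1{=}x_2$, $R(\bar x)$; $\neg$, $\vee$; $\exists y$ for structure variables; $\mathsf{P}(t_1,\dots,t_m)$, true iff the values of the counting terms lie in $[\![\mathsf{P}]\!]$; counting terms $\#\bar y.\varphi$ ($\bar y$ a tuple of $\ge1$ pairwise distinct structure variables) counting the tuples satisfying $\varphi$; integers; $+$, $\cdot$ of counting terms; number variables; $\exists\kappa\,\varphi$ with $\kappa$ ranging over $\{0,\dots,|A|\}$. $\mathrm{br}$ (binding rank) is the maximal nesting depth of constructs $\exists y$ ($y$ a structure variable) and $\#\bar y$; $\mathrm{bw}$ (binding width) is the maximal $|\bar y|$ over counting terms $\#\bar y.\psi$ occurring in the formula, and if none occurs, $1$ if some $\exists y$ with $y$ a structure variable occurs and $0$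 otherwise. The Gaifman graph of $\mathcal{A}$ has vertex set $A$ and an edge between distinct elements occurring together in a tuple of some relation. For a tuple $\bar a$, $N_r^{\mathcal{A}}(\bar a)$ is the set of elements at Gaifman distance $\le r$ from some entry of $\bar a$, and the $r$-sphere of $\bar a$ is the induced substructure on $N_r^{\mathcal{A}}(\bar a)$ together with the distinguished tuple $\bar a$. For $\bar a\in A^k$, $\bar b\in B^k$, $(\mathcal{A},\bar a)$ and $(\mathcal{B},\bar b)$ are $r$-equivalent if there is a bijection $f:A\to B$ such that for all $c\in A$ the $r$-sphere of $(\bar a,c)$ in $\mathcal{A}$ is isomorphic to the $r$-sphere of $(\bar b,f(c))$ in $\mathcal{B}$ (isomorphism respecting the distinguished tuples). A formula $\varphi(\bar x)$ with $k$ free structure variables and no free number variables is Hanf-local if there exists $r\ge0$ such that for all $\sigma$-structures $\mathcal{A},\mathcal{B}$ and all $\bar a\in A^k$, $\bar b\in B^k$ with $(\mathcal{A},\bar a)$ and $(\mathcal{B},\bar b)$ $r$-equivalent, $\mathcal{A}\models\varphi[\bar a]\iff\mathcal{B}\models\varphi[\bar b]$; the least such $r$ is the Hanf-locality rank $\mathrm{lr}(\varphi)$. *)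

(* Defs.v *)
From mathcomp Require Export all_boot all_order all_algebra.
From mathcomp Require Export boolp.
Set Implicit Arguments.
Unset Strict Implicit.
Unset Printing Implicit Defensive.
Import GRing.Theory Num.Theory.

Section Structures.
Variables (S : finType) (sar : S -> nat).

Record structure := Structure {
  carrier :> finType;
  elt0 : carrier;                               (* universe is non-empty *)
  srel : forall R : S, (sar R).-tuple carrier -> bool }.
Arguments srel : clear implicits.

Section Gaifman.
Variable A : structure.

Definition gadj (a b : A) : bool :=
  (a != b) && [exists R : S, exists t : (sar R).-tuple A,
                  [&& srel A R t, a \in t & b \in t]].

Fixpoint within (r : nat) (a b : A) : bool :=
  if r is r'.+1 then within r' a b || [exists c : A, within r' a c && gadj c b]
  else a == b.

Definition nbhd (r : nat) (k : nat) (a : k.-tuple A) : {set A} :=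
  [set c | [exists i : 'I_k, within r (tnth a i) c]].
End Gaifman.

Definition sphere_iso (r k : nat) (A B : structure)
    (a : k.-tuple A) (b : k.-tuple B) : Prop :=
  exists f : A -> B,
    [/\ {in nbhd r a &, injective f},
        f @: nbhd r a = nbhd r b,
        (forall i : 'I_k, f (tnth a i) = tnth b i) &
        (forall (R : S) (t : (sar R).-tuple A),
            (forall i, tnth t i \in nbhd r a) ->
            srel A R t = srel B R (map_tuple f t))].

Definition snoc_tuple (T : Type) (k : nat) (a : k.-tuple T) (c : T)
  : (k + 1).-tuple T := cat_tuple a [tuple c].

Definition r_equiv (r k : nat) (A B : structure)
    (a : k.-tuple A) (b : k.-tuple B) : Prop :=
  exists f : A -> B, bijective f /\
    forall c : A, sphere_iso r (snoc_tuple a c) (snoc_tuple b (f c)).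

End Structures.
Arguments srel {S sar} _ _ _.
Arguments elt0 {S sar} _.

(* Structure variables and number variables are both indexed by nat.        *)
(* A numerical predicate collection: a countable type P of names with       *)
(* arities par (>= 1, assumed in the theorem) and semantics                 *)
(* sem p : subset of Z^(par p).                                             *)

Section Logic.
Variables (S : finType) (sar : S -> nat) (P : countType) (par : P -> nat).

Inductive focn :=
| FEq   (x y : nat)
| FRel  (R : S) (xs : 'I_(sar R) -> nat)
| FNeg  (f : focn)
| FOr   (f g : focn)
| FEx   (y : nat) (f : focn)                     (* exists y (structure var) *)
| FPred (p : P) (ts : 'I_(par p) -> cterm)
| FExN  (k : nat) (f : focn)                     (* exists kappa (number var) *)
with cterm :=
| TCount (ys : seq nat) (f : focn)
| TInt   (z : int)
| TAdd   (s t : cterm)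
| TMul   (s t : cterm)
| TVar   (k : nat).                              (* number variable *)

Fixpoint wf_form (f : focn) : bool :=
  match f with
  | FEq _ _ | FRel _ _ => true
  | FNeg g | FEx _ g | FExN _ g => wf_form g
  | FOr g h => wf_form g && wf_form h
  | FPred p ts => [forall i, wf_term (ts i)]
  end
with wf_term (t : cterm) : bool :=
  match t with
  | TCount ys g => [&& ys != [::], uniq ys & wf_form g]
  | TInt _ | TVar _ => true
  | TAdd s u | TMul s u => wf_term s && wf_term u
  end.

Fixpoint sfree (x : nat) (f : focn) : bool :=
  match f with
  | FEq y z => (x == y) || (x == z)
  | FRel R xs => [exists i, xs i == x]
  | FNeg g | FExN _ g => sfree x g
  | FOr g h => sfree x g || sfree x h
  | FEx y g => (x != y) && sfree x g
  | FPred p ts => [exists i, sfree_t x (ts i)]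
  end
with sfree_t (x : nat) (t : cterm) : bool :=
  match t with
  | TCount ys g => (x \notin ys) && sfree x g
  | TInt _ | TVar _ => false
  | TAdd s u | TMul s u => sfree_t x s || sfree_t x u
  end.

Fixpoint nfree (k : nat) (f : focn) : bool :=
  match f with
  | FEq _ _ | FRel _ _ => false
  | FNeg g | FEx _ g => nfree k g
  | FOr g h => nfree k g || nfree k h
  | FExN l g => (k != l) && nfree k g
  | FPred p ts => [exists i, nfree_t k (ts i)]
  end
with nfree_t (k : nat) (t : cterm) : bool :=
  match t with
  | TCount _ g => nfree k g
  | TInt _ => false
  | TVar l => k == l
  | TAdd s u | TMul s u => nfree_t k s || nfree_t k u
  end.

Fixpoint br (f : focn) : nat :=
  match f with
  | FEq _ _ | FRel _ _ => 0
  | FNeg g | FExN _ g => br g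
  | FOr g h => maxn (br g) (br h)
  | FEx _ g => (br g).+1
  | FPred p ts => \max_(i < par p) br_t (ts i)
  end
with br_t (t : cterm) : nat :=
  match t with
  | TCount _ g => (br g).+1
  | TInt _ | TVar _ => 0
  | TAdd s u | TMul s u => maxn (br_t s) (br_t u)
  end.

Fixpoint cwidth (f : focn) : nat :=
  match f with
  | FEq _ _ | FRel _ _ => 0
  | FNeg g | FExN _ g | FEx _ g => cwidth g
  | FOr g h => maxn (cwidth g) (cwidth h)
  | FPred p ts => \max_(i < par p) cwidth_t (ts i)
  end
with cwidth_t (t : cterm) : nat :=
  match t with
  | TCount ys g => maxn (size ys) (cwidth g)
  | TInt _ | TVar _ => 0
  | TAdd s u | TMul s u => maxn (cwidth_t s) (cwidth_t u)
  end.

Fixpoint has_count (f : focn) : bool :=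
  match f with
  | FEq _ _ | FRel _ _ => false
  | FNeg g | FExN _ g | FEx _ g => has_count g
  | FOr g h => has_count g || has_count h
  | FPred p ts => [exists i, has_count_t (ts i)]
  end
with has_count_t (t : cterm) : bool :=
  match t with
  | TCount _ _ => true
  | TInt _ | TVar _ => false
  | TAdd s u | TMul s u => has_count_t s || has_count_t u
  end.

Fixpoint has_sex (f : focn) : bool :=
  match f with
  | FEq _ _ | FRel _ _ => false
  | FNeg g | FExN _ g => has_sex g
  | FEx _ _ => true
  | FOr g h => has_sex g || has_sex h
  | FPred p ts => [exists i, has_sex_t (ts i)]
  end
with has_sex_t (t : cterm) : bool :=
  match t with
  | TCount _ g => has_sex g
  | TInt _ | TVar _ => false
  | TAdd s u | TMul s u => has_sex_t s || has_sex_t u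
  end.

Definition bw (f : focn) : nat :=
  if has_count f then cwidth f else if has_sex f then 1 else 0.

Variable sem : forall p : P, (par p).-tuple int -> Prop.

Section Sem.
Variable A : structure sar.

Definition supd (beta : nat -> A) (y : nat) (a : A) : nat -> A :=
  fun z => if z == y then a else beta z.

Definition supds (beta : nat -> A) (ys : seq nat) (t : (size ys).-tuple A)
  : nat -> A :=
  fun z => if z \in ys then nth (beta z) t (index z ys) else beta z.

Definition nupd (nu : nat -> int) (k : nat) (n : int) : nat -> int :=
  fun l => if l == k then n else nu l.

Fixpoint focn_eval (beta : nat -> A) (nu : nat -> int) (f : focn) : bool :=
  match f with
  | FEq x y => beta x == beta y
  | FRel R xs => srel A R [tuple beta (xs i) | i < sar R]
  | FNeg g => ~~ focn_eval beta nu g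
  | FOr g h => focn_eval beta nu g || focn_eval beta nu h
  | FEx y g => [exists a : A, focn_eval (supd beta y a) nu g]
  | FPred p ts => `[< sem [tuple cterm_eval beta nu (ts i) | i < par p] >]
  | FExN k g => [exists n : 'I_(#|A|.+1), focn_eval beta (nupd nu k (n : nat)%:Z) g]
  end
with cterm_eval (beta : nat -> A) (nu : nat -> int) (t : cterm) : int :=
  match t with
  | TCount ys g =>
      (#|[set u : (size ys).-tuple A | focn_eval (@supds beta ys u) nu g]| : nat)%:Z
  | TInt z => z
  | TAdd s u => (cterm_eval beta nu s + cterm_eval beta nu u)%R
  | TMul s u => (cterm_eval beta nu s * cterm_eval beta nu u)%R
  | TVar k => nu k
  end.

(* A |= phi[abar] for phi(xbar); the free variables of phi are among xbar,
   phi has no free number variables, so the default values are irrelevant *)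
Definition focn_sat (k : nat) (xs : k.-tuple nat) (a : k.-tuple A) (f : focn) : bool :=
  focn_eval (fun z => if z \in xs then nth (elt0 A) a (index z xs) else elt0 A)
       (fun _ => 0%R) f.
End Sem.

Definition hanf_local_at (k : nat) (xs : k.-tuple nat) (f : focn) (r : nat)
  : Prop :=
  forall (A B : structure sar) (a : k.-tuple A) (b : k.-tuple B),
    r_equiv r a b -> (focn_sat xs a f <-> focn_sat xs b f).

Definition hanf_local (k : nat) (xs : k.-tuple nat) (f : focn) : Prop :=
  exists r, hanf_local_at xs f r.

End Logic.

(* Main.v *)
Require Import Defs.
Set Implicit Arguments.
Unset Strict Implicit.
Unset Printing Implicit Defensive.

(** Call two families of points weakly r-equivalent if their r-spheres are
    isomorphic and some bijection of the universes preserves the r-sphere of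
    every single point. This is weaker than r-equivalence, but it is all that
    FOCN sees: if (A,a) and (B,b) are weakly equivalent at radius
    R = m(2r+1) + r, then every isomorphism type of r-spheres around (a,c), c an
    m-tuple, is realized by equally many c in A and in B. Indeed, split such a
    sphere into its connected parts. A connected part lies in the R-ball of a or
    of a single point, so it can be moved along an isomorphism of R-spheres. For a
    disconnected sphere, multiply the numbers of realizations of two separated
    parts and subtract the cases in which the parts touch, whose types have more
    links and are dealt with by induction. Hence each counting or existential
    quantifier multiplies the radius plus one by at most 2w+1, where w is the
    binding width. *)

(** * Gaifman distance and isomorphisms of induced substructures *)

Section Within.
Variables (S : finType) (sar : S -> nat).
Implicit Types A B C : structure sar.

Lemma gadj_sym A (a b : A) : gadj a b = gadj b a.
Proof.
rewrite /gadj eq_sym; congr andb; apply: eq_existsb => R.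
by apply: eq_existsb => t; rewrite [(a \in t) && _]andbC.
Qed.

Lemma within_refl A n (a : A) : within n a a.
Proof. by elim: n => //= n ->. Qed.

Lemma withinS A n (a b c : A) : within n a b -> gadj b c -> within n.+1 a c.
Proof. by move=> ab bc /=; apply/orP; right; apply/existsP; exists b; rewrite ab. Qed.

Lemma within_trans A m n (a b c : A) :
  within m a b -> within n b c -> within (m + n) a c.
Proof.
move=> ab; elim: n c => [|n IH] c /=; first by rewrite addn0 => /eqP<-.
rewrite addnS /= => /orP[/IH->//|/existsP[d /andP[/IH bd dc]]].
by apply/orP; right; apply/existsP; exists d; rewrite bd.
Qed.

Lemma within_leq A m n (a b : A) : m <= n -> within m a b -> within n a b.
Proof.
move=> mn ab; rewrite -(subnKC mn).
exact: within_trans ab (within_refl (n - m) b).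
Qed.

Lemma within_sym A n (a b : A) : within n a b = within n b a.
Proof.
have imp (x y : A) : within n x y -> within n y x.
  elim: n x y => [|n IH] x y /=; first by rewrite eq_sym.
  move=> /orP[/IH->//|/existsP[d /andP[/IH xd dy]]].
  have : within (1 + n) y x.
    by apply: within_trans xd; apply: withinS (within_refl 0 y) _; rewrite gadj_sym.
  by rewrite add1n.
by apply/idP/idP; apply: imp.
Qed.

Lemma within_rel A n (a x y : A) R (t : (sar R).-tuple A) :
  srel A R t -> x \in t -> y \in t -> within n a x -> within n.+1 a y.
Proof.
move=> Rt xt yt ax; have [<-|xy] := eqVneq x y; first exact: within_leq ax.
apply: withinS ax _; rewrite /gadj xy; apply/existsP; exists R.
by apply/existsP; exists t; rewrite Rt xt.
Qed.

(** The map is total and only its values on [D] matter, which avoids building induced substructures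
    on subtypes. *)
Definition liso A B (f : A -> B) (D : {set A}) (E : {set B}) : Prop :=
  [/\ {in D &, injective f}, f @: D = E &
      forall R (t : (sar R).-tuple A), (forall i, tnth t i \in D) ->
        srel A R t = srel B R (map_tuple f t)].

Lemma liso_id A (D : {set A}) : liso id D D.
Proof.
split=> [x y //||R t _]; first exact: imset_id.
by congr (srel _ _ _); apply: val_inj; rewrite /= map_id.
Qed.

Lemma liso_comp A B C (f : A -> B) (g : B -> C) D E F :
  liso f D E -> liso g E F -> liso (g \o f) D F.
Proof.
move=> [fi fE fr] [gi gF gr]; have fD x : x \in D -> f x \in E.
  by move=> xD; rewrite -fE imset_f.
split=> [x y xD yD e||R t tD].
  by apply: fi => //; apply: gi e; apply: fD.
  by rewrite imset_comp fE.
rewrite fr // gr => [|i]; last by rewrite tnth_map fD.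
by congr (srel _ _ _); apply: val_inj; rewrite /= map_comp.
Qed.

Lemma liso_sub A B (f : A -> B) D E (D' : {set A}) :
  liso f D E -> D' \subset D -> liso f D' (f @: D').
Proof.
move=> [fi fE fr] /subsetP sD; split=> [x y /sD xD /sD yD||R t tD] //.
  exact: fi.
by apply: fr => i; apply: sD.
Qed.

Lemma liso_inv A B (f : A -> B) D E : liso f D E ->
  exists g : B -> A, liso g E D /\ {in D, cancel f g}.
Proof.
(* Off the image of [D] the value is arbitrary; a default exists because universes are non-empty. *)
move=> [fi fE fr]; pose g y := odflt (elt0 A) [pick x in D | f x == y].
have fK : {in D, cancel f g}.
  move=> x xD; rewrite /g; case: pickP => [z /andP[zD /eqP /fi->]//|].
  by move/(_ x); rewrite xD eqxx.
exists g; split=> //; split.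
- by rewrite -fE => _ _ /imsetP[x xD ->] /imsetP[y yD ->]; rewrite !fK // => ->.
- rewrite -fE -imset_comp -[RHS]imset_id; apply: eq_in_imset => x xD /=.
  exact: fK.
- move=> R t tE; have gE y : y \in E -> (g y \in D) /\ f (g y) = y.
    by rewrite -fE => /imsetP[x xD ->]; rewrite fK.
  rewrite [RHS]fr => [|i]; last by rewrite tnth_map; case: (gE _ (tE i)).
  congr (srel _ _ _); apply: eq_from_tnth => i; rewrite !tnth_map.
  by case: (gE _ (tE i)).
Qed.

(** Each edge on a path of length at most [n] from [x] is witnessed by a tuple with all entries
    within distance [n] of [x]. These lie in [D], so [f] preserves the tuple and with it the
    edge. *)
Lemma liso_within A B (f : A -> B) D E n (x y : A) :
  liso f D E -> (forall z, within n x z -> z \in D) ->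
  within n x y -> within n (f x) (f y).
Proof.
move=> [fi fE fr]; elim: n y => [|n IH] y xD; first by move=> /= /eqP->.
have {}IH z : within n x z -> within n (f x) (f z).
  by apply: IH => w xw; apply: xD; apply: within_leq xw.
move=> /= /orP[/IH->//|/existsP[c /andP[xc cy]]].
apply/orP; right; apply/existsP; exists (f c); rewrite IH //=.
have /andP[cny /existsP[R /existsP[t /and3P[Rt ct yt]]]] := cy.
have tD z : z \in t -> z \in D by move=> zt; apply: xD; apply: within_rel Rt ct zt xc.
rewrite /gadj; apply/andP; split.
  by apply: contra cny => /eqP /fi e; apply/eqP/e; apply: tD.
apply/existsP; exists R; apply/existsP; exists (map_tuple f t).
by rewrite -fr ?Rt ?map_f // => i; apply/tD/mem_tnth.
Qed.

End Within.

(** * Spheres around families of points, their links and their gluing *)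

Section Spheres.
Variables (S : finType) (sar : S -> nat).
Implicit Types (A B C : structure sar) (V W : finType).

Definition ballU A V r (U : {set V}) (p : V -> A) : {set A} :=
  [set c | [exists u in U, within r (p u) c]].

(** Families indexed by a finite type and cut down to a subset [U] stand in for distinguished
    tuples: passing to a part of a tuple then needs no renumbering. *)
Definition siso A B V r (U : {set V}) (p : V -> A) (q : V -> B) : Prop :=
  exists f : A -> B,
    liso f (ballU r U p) (ballU r U q) /\ {in U, forall u, f (p u) = q u}.

Lemma ballUP A V r (U : {set V}) (p : V -> A) x :
  reflect (exists2 u, u \in U & within r (p u) x) (x \in ballU r U p).
Proof. by rewrite inE; apply: exists_inP. Qed.

Lemma ballU_within A V r (U : {set V}) (p : V -> A) u x :
  u \in U -> within r (p u) x -> x \in ballU r U p.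
Proof. by move=> uU ux; apply/ballUP; exists u. Qed.

Lemma eq_ballU A V r (U : {set V}) (p p' : V -> A) :
  {in U, p =1 p'} -> ballU r U p = ballU r U p'.
Proof.
move=> e; apply/setP => x; apply/ballUP/ballUP => -[u uU].
  by rewrite e //; exists u.
by rewrite -e //; exists u.
Qed.

Lemma eq_siso A B V r (U : {set V}) (p p' : V -> A) (q q' : V -> B) :
  {in U, p =1 p'} -> {in U, q =1 q'} -> siso r U p q -> siso r U p' q'.
Proof.
move=> ep eq [f [lf fe]]; exists f; rewrite -(eq_ballU _ ep) -(eq_ballU _ eq).
by split=> // u uU; rewrite -ep // -eq // fe.
Qed.

Lemma siso_refl A V r (U : {set V}) (p : V -> A) : siso r U p p.
Proof. by exists id; split=> //; apply: liso_id. Qed.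

Lemma siso_sym A B V r (U : {set V}) (p : V -> A) (q : V -> B) :
  siso r U p q -> siso r U q p.
Proof.
move=> [f [lf fe]]; have [g [lg gK]] := liso_inv lf.
exists g; split=> // u uU; rewrite -fe // gK //.
exact: ballU_within uU (within_refl _ _).
Qed.

Lemma siso_trans A B C V r (U : {set V}) (p : V -> A) (q : V -> B) (s : V -> C) :
  siso r U p q -> siso r U q s -> siso r U p s.
Proof.
move=> [f [lf fe]] [g [lg ge]]; exists (g \o f).
by split=> [|u uU /=]; [apply: liso_comp lf lg | rewrite fe // ge].
Qed.

(** The [r]-ball of a point within [n] of a center stays inside the [(n + r)]-ball, so [f] maps it
    into the [r]-ball of the image point. The inverse of [f] moves balls back in the same way, which
    makes the inclusion an equality. *)
Lemma siso_push A B V W r n (U : {set V}) (p : V -> A) (q : V -> B)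
    (f : A -> B) (J : {set W}) (x : W -> A) :
  liso f (ballU (n + r) U p) (ballU (n + r) U q) -> {in U, forall u, f (p u) = q u} ->
  (forall j, j \in J -> exists2 u, u \in U & within n (p u) (x j)) ->
  siso r J x (f \o x).
Proof.
move=> lf fe xp; exists f; split=> //.
have sub : ballU r J x \subset ballU (n + r) U p.
  apply/subsetP => y /ballUP[j jJ xy]; have [u uU ux] := xp j jJ.
  exact: ballU_within uU (within_trans ux xy).
suff <- : f @: ballU r J x = ballU r J (f \o x) by apply: liso_sub lf sub.
apply/setP => y; apply/imsetP/ballUP => [[z /ballUP[j jJ jz] ->]|[j jJ jy]].
  exists j => //; apply: liso_within lf _ jz => w jw.
  by move/subsetP: sub; apply; apply: ballU_within jJ jw.
have [g [lg gK]] := liso_inv lf; have [u uU ux] := xp j jJ.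
have xD : x j \in ballU (n + r) U p.
  by apply: ballU_within uU _; apply: within_leq ux; apply: leq_addr.
have fux : within n (q u) (f (x j)).
  rewrite -fe //; apply: liso_within lf _ ux => w uw.
  by apply: ballU_within uU _; apply: within_leq uw; apply: leq_addr.
have bE w : within r (f (x j)) w -> w \in ballU (n + r) U q.
  by move=> h; apply: ballU_within uU (within_trans fux h).
exists (g y).
  by apply: ballU_within jJ _; rewrite -{1}(gK _ xD); apply: liso_within lg bE jy.
case: lf => fi fE _; move: (bE _ jy); rewrite -fE => /imsetP[z zD ->].
by rewrite gK.
Qed.

Lemma siso_reindex A B V W r n (U : {set V}) (p : V -> A) (q : V -> B)
    (J : {set W}) (h : W -> V) :
  r <= n -> {in J, forall j, h j \in U} -> siso n U p q ->
  siso r J (p \o h) (q \o h).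
Proof.
move=> rn hU [f [lf fe]]; rewrite -(subnK rn) in lf.
have: siso r J (p \o h) (f \o (p \o h)).
  by apply: siso_push lf fe _ => j jJ; exists (h j); rewrite ?hU ?within_refl.
by apply: eq_siso => // j jJ /=; rewrite fe ?hU.
Qed.

Lemma siso_mono A B V r n (U J : {set V}) (p : V -> A) (q : V -> B) :
  r <= n -> J \subset U -> siso n U p q -> siso r J p q.
Proof. by move=> rn /subsetP JU; apply: (siso_reindex (h := id)). Qed.

(** Requiring all entries of the tuple in [D] makes this a property of the induced substructure,
    hence invariant under isomorphisms of spheres. Adjacency in [A] may be witnessed by tuples that
    leave [D]. *)
Definition tie A (D : {set A}) (x y : A) : bool :=
  (x == y) || [exists R, exists t : (sar R).-tuple A,
    [&& srel A R t, [forall i, tnth t i \in D], x \in t & y \in t]].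

Definition btie A V r (U : {set V}) (p : V -> A) (u v : V) : bool :=
  [exists x, exists y,
     [&& within r (p u) x, within r (p v) y & tie (ballU r U p) x y]].

Lemma btieP A V r (U : {set V}) (p : V -> A) u v :
  reflect (exists x y, [/\ within r (p u) x, within r (p v) y
                         & tie (ballU r U p) x y]) (btie r U p u v).
Proof.
apply: (iffP existsP) => [[x /existsP[y /and3P[]]]|[x [y [h1 h2 h3]]]].
  by exists x, y.
by exists x; apply/existsP; exists y; rewrite h1 h2.
Qed.

Lemma tie_sym A (D : {set A}) x y : tie D x y = tie D y x.
Proof.
rewrite /tie eq_sym; congr orb; apply: eq_existsb => R.
by apply: eq_existsb => t; rewrite [(x \in t) && _]andbC.
Qed.

Lemma btie_sym A V r (U : {set V}) (p : V -> A) u v :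
  btie r U p u v = btie r U p v u.
Proof.
by apply/btieP/btieP => -[x [y [h1 h2 h3]]]; exists y, x; rewrite tie_sym.
Qed.

(** Go [r] steps from [p u] to [x], at most one step to [y], and [r] steps on to [p v]. *)
Lemma btie_within A V r (U : {set V}) (p : V -> A) u v :
  btie r U p u v -> within (2 * r).+1 (p u) (p v).
Proof.
move=> /btieP[x [y [ux vy xy]]]; rewrite mul2n -addnn -addSn.
rewrite within_sym in vy; apply: within_trans vy.
case/orP: xy => [/eqP<-|/existsP[R /existsP[t /and4P[Rt _ xt yt]]]].
  exact: within_leq ux.
exact: within_rel Rt xt yt ux.
Qed.

Lemma tie_subset A (D E : {set A}) x y : D \subset E -> tie D x y -> tie E x y.
Proof.
move=> /subsetP DE /orP[e|]; rewrite /tie ?e // => /existsP[R /existsP[t]].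
move=> /and4P[Rt /forallP tD xt yt]; apply/orP; right.
apply/existsP; exists R; apply/existsP; exists t; rewrite Rt xt yt !andbT.
by apply/forallP => i; apply: DE.
Qed.

Lemma ballU_subset A V r (J U : {set V}) (p : V -> A) :
  J \subset U -> ballU r J p \subset ballU r U p.
Proof.
move=> /subsetP JU; apply/subsetP => x /ballUP[u uJ ux].
exact: ballU_within (JU _ uJ) ux.
Qed.

Lemma btie_subset A V r (J U : {set V}) (p : V -> A) u v :
  J \subset U -> btie r J p u v -> btie r U p u v.
Proof.
move=> JU /btieP[x [y [ux vy xy]]]; apply/btieP; exists x, y; split=> //.
exact: tie_subset (ballU_subset _ _ JU) xy.
Qed.

Lemma siso_btie A B V r (U : {set V}) (p : V -> A) (q : V -> B) u v :
  siso r U p q -> u \in U -> v \in U -> btie r U p u v = btie r U q u v.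
Proof.
move=> pq uU vU.
have imp C C' (s : V -> C) (s' : V -> C') :
    siso r U s s' -> btie r U s u v -> btie r U s' u v.
  move=> [f [lf fe]] /btieP[x [y [ux vy xy]]].
  have fw w z : w \in U -> within r (s w) z -> within r (s' w) (f z).
    move=> wU wz; rewrite -fe //; apply: liso_within lf _ wz => t.
    exact: ballU_within.
  apply/btieP; exists (f x), (f y); split; [exact: fw|exact: fw|].
  case/orP: xy => [/eqP->|/existsP[R /existsP[t]]]; first by rewrite /tie eqxx.
  move=> /and4P[Rt /forallP tD xt yt]; apply/orP; right; case: lf => fi fE fr.
  apply/existsP; exists R; apply/existsP; exists (map_tuple f t).
  rewrite -fr // Rt !map_f // !andbT /=.
  by apply/forallP => i; rewrite tnth_map -fE imset_f.
by apply/idP/idP; apply: imp => //; apply: siso_sym.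
Qed.

(* If nothing ties J to K, a tie inside J only uses points of the J-balls. *)
Lemma btie_setU A V r (J K : {set V}) (p : V -> A) u v :
  (forall u v, u \in J -> v \in K -> ~~ btie r (J :|: K) p u v) ->
  u \in J -> v \in J -> btie r (J :|: K) p u v -> btie r J p u v.
Proof.
move=> sep uJ vJ /btieP[x [y [ux vy xy]]]; apply/btieP; exists x, y; split=> //.
case/orP: xy => [/eqP->|/existsP[R /existsP[t /and4P[Rt /forallP tD xt yt]]]].
  by rewrite /tie eqxx.
apply/orP; right; apply/existsP; exists R; apply/existsP; exists t.
rewrite Rt xt yt !andbT /=; apply/forallP => i.
have /ballUP[w] := tD i; rewrite inE => /orP[wJ|wK] wi.
  exact: ballU_within wJ wi.
have /negP[] := sep u w uJ wK; apply/btieP; exists x, (tnth t i); split=> //.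
apply/orP; right; apply/existsP; exists R; apply/existsP; exists t.
by rewrite Rt xt mem_tnth !andbT; apply/forallP.
Qed.

(** Without ties the balls of [J] and of [K] are disjoint and no tuple of a relation inside their
    union meets both. The two isomorphisms can therefore be merged. *)
Lemma siso_glue A B V r (J K : {set V}) (p : V -> A) (q : V -> B) :
  (forall u v, u \in J -> v \in K -> ~~ btie r (J :|: K) p u v) ->
  (forall u v, u \in J -> v \in K -> ~~ btie r (J :|: K) q u v) ->
  siso r J p q -> siso r K p q -> siso r (J :|: K) p q.
Proof.
have sepD C (s : V -> C) x y :
    (forall u v, u \in J -> v \in K -> ~~ btie r (J :|: K) s u v) ->
    x \in ballU r J s -> y \in ballU r K s -> ~~ tie (ballU r (J :|: K) s) x y.
  move=> sep /ballUP[u uJ ux] /ballUP[v vK vy]; apply: contra (sep u v uJ vK) => xy.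
  by apply/btieP; exists x, y.
have ballD C (s : V -> C) : ballU r (J :|: K) s = ballU r J s :|: ballU r K s.
  apply/setP => x; rewrite in_setU.
  apply/ballUP/orP => [[u]|[]/ballUP[u uJ ux]].
  - by rewrite in_setU => /orP[] uJ ux; [left|right]; apply: ballU_within uJ ux.
  - by exists u; rewrite ?in_setU ?uJ.
  - by exists u; rewrite ?in_setU ?uJ ?orbT.
have relD C (s : V -> C) R (t : (sar R).-tuple C) i j :
    (forall u v, u \in J -> v \in K -> ~~ btie r (J :|: K) s u v) ->
    (forall i, tnth t i \in ballU r (J :|: K) s) ->
    tnth t i \in ballU r J s -> tnth t j \in ballU r K s -> srel C R t = false.
  move=> sep tD iJ jK; apply/negP => Rt; have /negP[] := sepD _ _ _ _ sep iJ jK.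
  apply/orP; right; apply/existsP; exists R; apply/existsP; exists t.
  by rewrite Rt !mem_tnth !andbT; apply/forallP.
move=> sp sq [f1 [l1 e1]] [f2 [l2 e2]].
have [i1 E1 r1] := l1; have [i2 E2 r2] := l2.
pose f x := if x \in ballU r J p then f1 x else f2 x.
have dis C (s : V -> C) x :
    (forall u v, u \in J -> v \in K -> ~~ btie r (J :|: K) s u v) ->
    x \in ballU r J s -> x \in ballU r K s -> False.
  by move=> sep xJ xK; have := sepD _ _ _ _ sep xJ xK; rewrite /tie eqxx.
have fJ x : x \in ballU r J p -> f x = f1 x by rewrite /f => ->.
have fK x : x \in ballU r K p -> f x = f2 x.
  by rewrite /f; case: ifP => // xJ xK; case: (dis _ _ _ sp xJ xK).
have fJ' x : x \in ballU r J p -> f x \in ballU r J q.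
  by move=> xJ; rewrite fJ // -E1 imset_f.
have fK' x : x \in ballU r K p -> f x \in ballU r K q.
  by move=> xJ; rewrite fK // -E2 imset_f.
exists f; split; last first.
  move=> u; rewrite in_setU => /orP[] uJ.
    by rewrite fJ ?e1 //; apply: ballU_within uJ (within_refl _ _).
  by rewrite fK ?e2 //; apply: ballU_within uJ (within_refl _ _).
split.
- move=> x y; rewrite ballD !in_setU => /orP[] xD /orP[] yD e.
  + by apply: i1 => //; rewrite -!fJ.
  + by case: (dis _ q (f x) sq); rewrite ?fJ' // e fK'.
  + by case: (dis _ q (f y) sq); rewrite ?fJ' // -e fK'.
  + by apply: i2 => //; rewrite -!fK.
- rewrite !ballD imsetU -E1 -E2; congr (_ :|: _); exact: eq_in_imset.
- move=> R t tD.
  (* A tuple that misses the [J]-ball is handled by [f2], and this includes the tuple of length 0;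
     one that misses the [K]-ball is handled by [f1]. A tuple meeting both lies in no relation on
     either side. *)
  have [/existsP[i iJ]|/existsPn nJ] :=
    boolP [exists i, tnth t i \in ballU r J p]; last first.
    have tK i : tnth t i \in ballU r K p.
      by move: (tD i) (nJ i); rewrite ballD in_setU => /orP[->|].
    rewrite r2 //; congr (srel _ _ _); apply: eq_from_tnth => i.
    by rewrite !tnth_map fK.
  have [/existsP[j jK]|/existsPn nK] :=
    boolP [exists i, tnth t i \in ballU r K p]; last first.
    have tJ i' : tnth t i' \in ballU r J p.
      by move: (tD i') (nK i'); rewrite ballD in_setU => /orP[->|->].
    rewrite r1 //; congr (srel _ _ _); apply: eq_from_tnth => i'.
    by rewrite !tnth_map fJ.
  rewrite (relD _ p _ _ i j) //; symmetry; apply: (relD _ q _ _ i j) => //.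
  + move=> l; rewrite tnth_map ballD in_setU; move: (tD l); rewrite ballD in_setU.
    by case/orP => h; rewrite ?(fJ' _ h) ?(fK' _ h) ?orbT.
  + by rewrite tnth_map fJ'.
  + by rewrite tnth_map fK'.
Qed.

End Spheres.

(** * Two counting principles for finite types *)

(** Remove from [Phi] the class of one of its elements and induct on the size of [Phi]. A single
    relation on the sum type lets one class have members on both sides. *)
Lemma card_eq_classes (X Y : finType) (e : rel (X + Y)) (Phi : pred (X + Y)) :
  equivalence_rel e ->
  (forall z z', e z z' -> Phi z = Phi z') ->
  (forall z, Phi z -> #|[set x | e z (inl x)]| = #|[set y | e z (inr y)]|) ->
  #|[set x | Phi (inl x)]| = #|[set y | Phi (inr y)]|.
Proof.
move=> ee; have er z : e z z by case: (ee z z z).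
have et z1 z2 z3 : e z1 z2 -> e z1 z3 = e z2 z3 by case: (ee z1 z2 z3).
have [n] := ubnP #|Phi|; elim: n Phi => // n IH Phi ltn inv cls.
have [z Pz|Phi0] := pickP Phi; last first.
  by rewrite !(eq_card0 (A := [set _ | _])) // => w; rewrite inE Phi0.
pose Psi w := Phi w && ~~ e z w.
have -> : [set x | Phi (inl x)] = [set x | e z (inl x)] :|: [set x | Psi (inl x)].
  apply/setP => x; rewrite !inE /Psi; case: (boolP (e z _)) => [/inv <-//|_].
  by rewrite andbT.
have -> : [set y | Phi (inr y)] = [set y | e z (inr y)] :|: [set y | Psi (inr y)].
  apply/setP => x; rewrite !inE /Psi; case: (boolP (e z _)) => [/inv <-//|_].
  by rewrite andbT.
rewrite !cardsU cls // IH.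
- congr (_ - _); rewrite [_ :&: _](_ : _ = set0) ?cards0.
    by rewrite [_ :&: _](_ : _ = set0) ?cards0 //; apply/setP => x;
      rewrite !inE /Psi; case: (e z _); rewrite ?andbF.
  by apply/setP => x; rewrite !inE /Psi; case: (e z _); rewrite ?andbF.
- rewrite ltnS in ltn; apply: leq_trans ltn; apply: proper_card.
  rewrite properE; apply/andP; split; first by apply/subsetP => w /andP[].
  by apply/subsetPn; exists z; rewrite ?unfold_in // /Psi er andbF.
- move=> w w' ww'; rewrite /Psi (inv _ _ ww'); congr (_ && ~~ _).
  have es a b : e a b -> e b a by move=> ab; rewrite -(et _ _ a ab) er.
  by apply/idP/idP => /es h; apply: es; rewrite ?(et _ _ z ww') // -(et _ _ z ww').
- by move=> w /andP[/cls].
Qed.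

(* Exchanging the coordinates outside J of two tuples is a bijection from P * Q
   to (P :&: Q) * X^m. *)
Lemma card_independent (X : finType) m (J : pred 'I_m) (P Q : {set m.-tuple X}) :
  (forall c d, (forall i, J i -> tnth c i = tnth d i) -> c \in P -> d \in P) ->
  (forall c d, (forall i, ~~ J i -> tnth c i = tnth d i) -> c \in Q -> d \in Q) ->
  #|P| * #|Q| = #|P :&: Q| * #|X| ^ m.
Proof.
move=> Pi Qi.
pose mix (c d : m.-tuple X) := [tuple if J i then tnth c i else tnth d i | i < m].
pose sw (z : m.-tuple X * m.-tuple X) := (mix z.1 z.2, mix z.2 z.1).
have swK : involutive sw.
  move=> [c d]; rewrite /sw /=; congr (_, _); apply: eq_from_tnth => i;
  by rewrite !tnth_mktuple; case: (J i).
rewrite -card_tuple -cardsT -!cardsX -[RHS](card_preimset _ (inv_inj swK)).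
congr #|pred_of_set _|; apply/setP => -[c d]; rewrite !inE /= andbT.
have mJ c' d' i : J i -> tnth (mix c' d') i = tnth c' i by rewrite tnth_mktuple => ->.
have mK c' d' i : ~~ J i -> tnth (mix c' d') i = tnth d' i.
  by rewrite tnth_mktuple => /negPf ->.
apply/andP/andP => -[Pc Qc]; split.
- by apply: Pi Pc => i /mJ->.
- by apply: Qi Qc => i /mK->.
- by apply: Pi Pc => i /mJ->.
- by apply: Qi Qc => i /mK->.
Qed.

(** * Counting the tuples with a prescribed sphere type *)

Section Types.
Variables (S : finType) (sar : S -> nat).
Implicit Types (A B C : structure sar) (V W : finType).

Definition extend A V m (p : V -> A) (c : m.-tuple A) (s : V + 'I_m) : A :=
  match s with inl v => p v | inr i => tnth c i end.

(** An isomorphism type is represented by a family [gam] in an arbitrary structure [C]. The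
    induction below needs this freedom, as it passes to types represented in [A] or in [B]. *)
Definition realizers A C V m r (U : {set V + 'I_m}) (p : V -> A)
    (gam : V + 'I_m -> C) : {set m.-tuple A} :=
  [set c | `[< siso r U (extend p c) gam >]].

Definition weak_equiv A B V r (p : V -> A) (q : V -> B) : Prop :=
  siso r setT p q /\
  exists g : A -> B, bijective g /\
    forall x, siso r [set: unit] (fun=> x) (fun=> g x).

(* The points of p count as a single block: they are linked to each other. *)
Definition linked C V m r (U : {set V + 'I_m}) (gam : V + 'I_m -> C) :
    rel (V + 'I_m) :=
  fun u v => [&& u \in U, v \in U & (is_inl u && is_inl v) || btie r U gam u v].

Lemma weak_equiv_sym A B V r (p : V -> A) (q : V -> B) :
  weak_equiv r p q -> weak_equiv r q p.
Proof.
move=> [pq [g [[h gK hK] gs]]]; split; first exact: siso_sym.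
exists h; split; first by exists g.
by move=> x; apply: siso_sym; rewrite -{2}(hK x).
Qed.

Lemma weak_equiv_mono A B V r n (p : V -> A) (q : V -> B) :
  r <= n -> weak_equiv n p q -> weak_equiv r p q.
Proof.
move=> rn [pq [g [gb gs]]]; split; first exact: siso_mono pq.
by exists g; split=> // x; apply: siso_mono (gs x).
Qed.

Lemma siso_linked C C' V m r (U : {set V + 'I_m}) (gam : V + 'I_m -> C)
    (del : V + 'I_m -> C') :
  siso r U gam del -> linked r U gam =2 linked r U del.
Proof.
move=> gd u v; rewrite /linked; case: (boolP (u \in U)) => //= uU.
by case: (boolP (v \in U)) => //= vU; rewrite (siso_btie gd).
Qed.

(* Along a path, the distance to the set of centers z grows by at most 2r+1 at
   every vertex outside the block. *)
Lemma linked_path_within A V W m r (U : {set V + 'I_m}) (p : V + 'I_m -> A)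
    (z : W -> A) u s n :
  (forall v, v \in U -> is_inl v -> exists w, z w = p v) ->
  path (linked r U p) u s ->
  (exists w, within (n * (2 * r).+1) (z w) (p u)) ->
  exists w, within ((n + count (predC is_inl) s) * (2 * r).+1) (z w) (p (last u s)).
Proof.
move=> zc; elim: s u n => [|v s IH] u n /=; first by rewrite addn0.
move=> /andP[/and3P[uU vU uv] vs] [w wu]; rewrite addnA.
apply: IH => //; have [vl|nvl] := boolP (is_inl v).
  by have [w' e] := zc _ vU vl; exists w'; rewrite e within_refl.
exists w; rewrite /= mulnDl mul1n; apply: within_trans wu _.
by case/orP: uv => [/andP[_ vl]|/btie_within//]; rewrite vl in nvl.
Qed.

Lemma count_inr V m (s : seq (V + 'I_m)) : uniq s -> count (predC is_inl) s <= m.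
Proof.
move=> us; rewrite -size_filter -[X in _ <= X]card_ord.
have <- : size [seq @inr V 'I_m i | i <- enum 'I_m] = #|'I_m|.
  by rewrite size_map -cardE.
apply: uniq_leq_size; first exact: filter_uniq.
move=> [v|i]; rewrite mem_filter //= => _.
by rewrite mem_map ?mem_enum // => ? ? [].
Qed.

(** A realizer of a connected type stays within [m * (2 * r).+1] of the block [p], or of its own
    coordinate [j0] if [U] avoids the block. An isomorphism of large spheres thus carries it
    injectively to a realizer on the other side. *)
Lemma realizers_le A B C V m r R (U : {set V + 'I_m}) (p : V -> A) (q : V -> B)
    (gam : V + 'I_m -> C) u0 :
  weak_equiv R p q -> m * (2 * r).+1 + r <= R -> u0 \in U ->
  (forall u, u \in U -> is_inl u -> is_inl u0) ->
  (forall u, u \in U -> connect (linked r U gam) u0 u) ->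
  #|realizers r U p gam| <= #|realizers r U q gam|.
Proof.
move=> pq leR u0U u0l con; have [[h [lh he]] [g [gb gs]]] := weak_equiv_mono leR pq.
have gi := bij_inj gb; set n := m * (2 * r).+1 in lh gs.
(* Coordinates outside [U] are unconstrained and follow the bijection [g]; those in [U] follow a
   local isomorphism [H]. *)
pose T (H : A -> B) (c : m.-tuple A) :=
  [tuple if inr i \in U then H (tnth c i) else g (tnth c i) | i < m].
(* [H] may depend on the tuple being moved, so injectivity also requires that the image determine
   [H] and its domain. *)
have gen (H : m.-tuple A -> A -> B) (D : m.-tuple A -> {set A}) :
    (forall c, c \in realizers r U p gam ->
       [/\ {in D c &, injective (H c)}, forall i, inr i \in U -> tnth c i \in D c
         & siso r U (extend p c) (extend q (T (H c) c))]) ->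
    (forall c d, c \in realizers r U p gam -> d \in realizers r U p gam ->
       T (H c) c = T (H d) d -> H c = H d /\ D c = D d) ->
    #|realizers r U p gam| <= #|realizers r U q gam|.
  move=> H1 H2; rewrite -(card_in_imset (f := fun c => T (H c) c)).
    apply/subset_leq_card/subsetP => _ /imsetP[c cP ->].
    have [_ _ s] := H1 _ cP; rewrite !inE in cP *; apply/asboolP.
    exact: siso_trans (siso_sym s) (asboolW cP).
  move=> c d cP dP e; have [eH eD] := H2 _ _ cP dP e.
  have [Hi cD _] := H1 _ cP; have [_ dD _] := H1 _ dP.
  apply: eq_from_tnth => i; have := congr1 (fun t => tnth t i) e.
  rewrite !tnth_mktuple -eH; case: ifP => iU; last exact: gi.
  by apply: Hi; rewrite ?cD // eD dD.
have cpath c u : c \in realizers r U p gam -> u \in U ->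
    exists s, [/\ path (linked r U (extend p c)) u0 s, last u0 s = u
                & uniq (u0 :: s)].
  rewrite inE => /asboolP /siso_linked lk /con.
  rewrite -(eq_connect lk) => /connectP[s' us' ->].
  by case/shortenP: us' => s us un _; exists s.
(* If [u0] is a block point, the isomorphism [h] around [p] serves all tuples. Otherwise the tuple
   hangs on its coordinate [j0], and the isomorphism around that single point is used. *)
case eu0 : u0 => [v0|j0].
- have bnd c u : c \in realizers r U p gam -> u \in U ->
      exists2 v, v \in setT & within n (p v) (extend p c u).
    move=> cP /(cpath _ _ cP)[s [us <- /andP[_ /count_inr ls]]].
    have [||v vu] := linked_path_within (z := p) (n := 0) _ us.
    + by case=> // v _ _; exists v.
    + by exists v0; rewrite eu0 within_refl.
    exists v => //; apply: within_leq vu.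
    by rewrite add0n leq_mul2r ls orbT.
  apply: (gen (fun=> h) (fun=> ballU (n + r) setT p)) => // c cP; split.
  + by case: lh.
  + move=> i /(bnd c _ cP)[v vT vi]; apply: ballU_within vT _.
    by apply: within_leq vi; apply: leq_addr.
  + apply: (eq_siso _ _ (siso_push lh he (bnd c ^~ cP))) => // -[v|i] iU /=.
      by rewrite he.
    by rewrite tnth_mktuple iU.
have noinl v : inl v \in U -> False by move=> /u0l; rewrite eu0 => /(_ isT).
have [hh hhP] := choice gs.
have bnd c u : c \in realizers r U p gam -> u \in U ->
    exists2 v : unit, v \in setT & within n (tnth c j0) (extend p c u).
  move=> cP /(cpath _ _ cP)[s [us <- /andP[_ /count_inr ls]]].
  have [||v vu] := linked_path_within (z := fun _ : unit => tnth c j0) (n := 0) _ us.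
  + by case=> // v /noinl.
  + by exists tt; rewrite eu0 within_refl.
  exists tt => //; apply: within_leq vu.
  by rewrite add0n leq_mul2r ls orbT.
have hj0 x : hh x x = g x by have [_ /(_ tt (in_setT _))] := hhP x.
apply: (gen (fun c => hh (tnth c j0)) (fun c => ballU (n + r) [set: unit] (fun=> tnth c j0))).
  move=> c cP; have [lc ce] := hhP (tnth c j0); split.
  + by case: lc.
  + move=> i /(bnd c _ cP)[v vT vi]; apply: ballU_within vT _.
    by apply: within_leq vi; apply: leq_addr.
  + apply: (eq_siso _ _ (siso_push lc ce (bnd c ^~ cP))) => // -[v|i] iU /=.
      by case: (noinl v).
    by rewrite tnth_mktuple iU.
(* Coordinate [j0] of the image is the image under [g] of coordinate [j0] of the tuple, so it
   reveals the center and hence the isomorphism that was used. *)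
move=> c d cP dP /(congr1 (fun t => tnth t j0)).
by rewrite !tnth_mktuple -eu0 u0U !hj0 => /gi ->.
Qed.

Lemma realizers_local A C V m r (U : {set V + 'I_m}) (p : V -> A)
    (gam : V + 'I_m -> C) (c d : m.-tuple A) :
  (forall i, inr i \in U -> tnth c i = tnth d i) ->
  c \in realizers r U p gam -> d \in realizers r U p gam.
Proof.
move=> cd; rewrite !inE => /asboolP s; apply/asboolP.
by apply: eq_siso s => // -[v|i] iU //=; apply: cd.
Qed.

(** Block points do not vary with the tuple, so the two conditions constrain disjoint sets of
    coordinates and are independent. *)
Lemma card_realizersI A C V m r (J K : {set V + 'I_m}) (p : V -> A)
    (gam : V + 'I_m -> C) :
  [disjoint J & K] ->
  #|realizers r J p gam| * #|realizers r K p gam|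
  = #|realizers r J p gam :&: realizers r K p gam| * #|A| ^ m.
Proof.
move=> dJK; apply: (@card_independent A m (fun i => inr i \in J)) => c d cd.
  exact: realizers_local.
by apply: realizers_local => i iK; apply: cd; rewrite (disjointFl dJK iK).
Qed.

(** Packing the structure with the family lets tuples over [A] and over [B] be compared by a single
    relation. *)
Definition joint_point A B V m (p : V -> A) (q : V -> B) (z : m.-tuple A + m.-tuple B) :
    {D : structure sar & V + 'I_m -> D} :=
  match z with
  | inl c => existT _ A (extend p c)
  | inr c => existT _ B (extend q c)
  end.

(** On the sum of the two tuple types, the classes of equal sphere type are pairs of realizer sets.
    A property invariant under sphere type is a union of such classes. *)
Lemma card_siso_invariant A B V m r (U : {set V + 'I_m}) (p : V -> A) (q : V -> B)
    (Phi : pred (m.-tuple A + m.-tuple B)) :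
  let pt z := projT2 (joint_point p q z) in
  (forall z z', siso r U (pt z) (pt z') -> Phi z -> Phi z') ->
  (forall z, Phi z -> #|realizers r U p (pt z)| = #|realizers r U q (pt z)|) ->
  #|[set c | Phi (inl c)]| = #|[set d | Phi (inr d)]|.
Proof.
move=> pt inv cls.
apply: (@card_eq_classes _ _ (fun z z' => `[< siso r U (pt z) (pt z') >])).
- move=> z1 z2 z3; split; first by apply/asboolP/siso_refl.
  move=> /asboolP z12; apply/asboolP/asboolP; apply: siso_trans => //.
  exact: siso_sym.
- by move=> z z' /asboolP zz'; apply/idP/idP; apply: inv => //; apply: siso_sym.
move=> z /cls; set a := #|_|; set b := #|_| => ab.
have -> : [set x | `[< siso r U (pt z) (pt (inl x)) >]] = realizers r U p (pt z).
  by apply/setP => c; rewrite !inE; apply/asboolP/asboolP => /siso_sym.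
rewrite -/a ab; congr #|pred_of_set _|.
by apply/setP => c; rewrite !inE; apply/asboolP/asboolP => /siso_sym.
Qed.

(** Outer induction on the size of [U], inner induction on the number of unlinked pairs. Connected
    types are settled by [realizers_le] in both directions; a disconnected one is split into a
    component [J] and the rest [K]. *)
Lemma card_realizers A B C V m r R (U : {set V + 'I_m}) (p : V -> A) (q : V -> B)
    (gam : V + 'I_m -> C) :
  weak_equiv R p q -> m * (2 * r).+1 + r <= R ->
  #|realizers r U p gam| = #|realizers r U q gam|.
Proof.
move=> pq leR.
have cAB : #|A| = #|B| by have [_ [g [gb _]]] := pq; apply: bij_eq_card gb.
have [n] := ubnP #|U|; elim: n U C gam => // n IHn U C gam leU.
pose nl C' (del : V + 'I_m -> C') :=
  #|[set uv : (V + 'I_m) * (V + 'I_m) | ~~ linked r U del uv.1 uv.2]|.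
have [k] := ubnP (nl C gam); elim: k C gam => // k IHk C gam lek.
(* The start [u0] is taken in the block whenever [U] meets it, as [realizers_le] demands. *)
have dec : {u0 | u0 \in U & forall u, u \in U -> is_inl u -> is_inl u0}
    + {U = set0}.
  have [u /andP[uU ul]|nol] := pickP [pred u in U | is_inl u]; first by left; exists u.
  have [u uU|noU] := pickP (mem U); last by right; apply/setP => u; rewrite inE; apply: noU.
  by left; exists u => // v vU vl; have := nol v; rewrite /= vU vl.
(* Even the empty index set has a type, given by the relations of arity 0. *)
case: dec => [[u0 u0U u0l]|U0]; last first.
  have eqv c d : (c \in realizers r U p gam) = (d \in realizers r U q gam).
    have [[f [lf fe]] _] := weak_equiv_mono leR pq.
    have cd : siso r U (extend p c) (extend q d).
      have : siso r U (extend p c) (f \o extend p c).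
        by apply: siso_push lf fe _ => u; rewrite U0 inE.
      by apply: eq_siso => // u; rewrite U0 inE.
    rewrite !inE; apply/asboolP/asboolP; apply: siso_trans => //.
    exact: siso_sym.
  pose c0 := [tuple elt0 A | _ < m].
  have [b bq] : exists b, forall d, (d \in realizers r U q gam) = b.
    by exists (c0 \in realizers r U p gam) => d; rewrite (eqv c0 d).
  have -> : realizers r U q gam = [set _ | b] by apply/setP => d; rewrite bq inE.
  have -> : realizers r U p gam = [set _ | b].
    by apply/setP => c; rewrite (eqv c [tuple elt0 B | _ < m]) bq inE.
  have card_cst (T : finType) : #|[set _ : T | b]| = b * #|T|.
    case: (b); first by rewrite mul1n -cardsT; apply: eq_card => x; rewrite !inE.
    by apply: eq_card0 => x; rewrite inE.
  by rewrite !card_cst !card_tuple cAB.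
pose J := [set u in U | connect (linked r U gam) u0 u].
have u0J : u0 \in J by rewrite inE u0U connect0.
have JU : J \subset U by apply/subsetP => u; rewrite inE => /andP[].
have [eJ|nJ] := eqVneq J U.
  have con u : u \in U -> connect (linked r U gam) u0 u.
    by rewrite -{1}eJ inE => /andP[].
  apply/eqP; rewrite eqn_leq (realizers_le pq leR u0U) //=.
  exact: (realizers_le (weak_equiv_sym pq) leR u0U).
pose K := U :\: J.
have UE : J :|: K = U by rewrite /K setDE setUIr setUCr setIT; apply/setUidPr.
have dJK : [disjoint J & K] by rewrite disjoints_subset /K setCD subsetUr.
have KU : K \subset U by apply: subsetDl.
have sep u v : u \in J -> v \in K -> ~~ linked r U gam u v.
  move=> uJ; rewrite !inE => /andP[nv vU]; apply: contra nv => uv.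
  by rewrite vU /=; move: uJ; rewrite inE => /andP[_ uu]; apply: connect_trans (connect1 uv).
have ltJ : #|J| < #|U| by apply: proper_card; rewrite properEneq nJ.
have ltK : #|K| < #|U|.
  rewrite -(cardsID J U) (setIidPr JU) -[X in X < _]add0n ltn_add2r.
  by apply/card_gt0P; exists u0.
(* By independence each side, times the number of all [m]-tuples, is a product of counts known from
   the outer induction. That number is positive and the same for [A] and [B], so it cancels. *)
have eI : #|realizers r J p gam :&: realizers r K p gam|
        = #|realizers r J q gam :&: realizers r K q gam|.
  have : 0 < #|A| ^ m by rewrite expn_gt0; apply/orP; left; apply/card_gt0P; exists (elt0 A).
  move=> Am; apply/eqP; rewrite -(eqn_pmul2r Am) -card_realizersI // cAB.
  rewrite -card_realizersI // (IHn J) ?(IHn K) //.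
    exact: leq_trans ltK _.
  exact: leq_trans ltJ _.
have sub (D : structure sar) (s : V -> D) :
    realizers r U s gam \subset realizers r J s gam :&: realizers r K s gam.
  apply/subsetP => c; rewrite !inE => /asboolP h.
  by apply/andP; split; apply/asboolP; apply: siso_mono h.
rewrite -(setIidPr (sub _ p)) -(setIidPr (sub _ q)).
move: eI; rewrite -(cardsID (realizers r U p gam)) -[RHS](cardsID (realizers r U q gam)).
(* It remains to count the tuples whose [J]-part and [K]-part have the right types although the
   whole has not. *)
suff -> : #|realizers r J p gam :&: realizers r K p gam :\: realizers r U p gam|
   = #|realizers r J q gam :&: realizers r K q gam :\: realizers r U q gam| by move/addIn.
pose pt z := projT2 (joint_point (m := m) p q z).
pose Phi z := [&& `[< siso r J (pt z) gam >], `[< siso r K (pt z) gam >]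
                & ~~ `[< siso r U (pt z) gam >]].
have := @card_siso_invariant _ _ _ _ r U p q Phi.
have -> : [set x | Phi (inl x)] =
    realizers r J p gam :&: realizers r K p gam :\: realizers r U p gam.
  by apply/setP => c; rewrite !inE /Phi andbA andbC.
have -> : [set y | Phi (inr y)] =
    realizers r J q gam :&: realizers r K q gam :\: realizers r U q gam.
  by apply/setP => c; rewrite !inE /Phi andbA andbC.
apply.
  move=> z z' zz' /and3P[/asboolP zJ /asboolP zK /asboolP nzU].
  have zz's (L : {set V + 'I_m}) : L \subset U -> siso r L (pt z') (pt z).
    by move=> LU; apply: siso_sym; apply: siso_mono zz'.
  apply/and3P; split; apply/asboolP.
  - exact: siso_trans (zz's _ JU) zJ.
  - exact: siso_trans (zz's _ KU) zK.
  - by move=> /(siso_trans zz').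
move=> z /and3P[/asboolP zJ /asboolP zK /asboolP nzU]; rewrite -/(pt z).
(* The type of such a tuple keeps every link of [gam], since these lie inside [J] or inside [K], and
   it gains a link between [J] and [K]: otherwise gluing would give the whole sphere the type of
   [gam]. *)
apply: IHk; rewrite ltnS in lek; apply: leq_trans lek; apply: proper_card.
have nbt C' (del : V + 'I_m -> C') u v :
    u \in J -> v \in K -> ~~ linked r U del u v -> ~~ btie r (J :|: K) del u v.
  move=> uJ vK; rewrite /linked (subsetP JU _ uJ) (subsetP KU _ vK) /= UE.
  by rewrite negb_or => /andP[].
have gsep u v : u \in J -> v \in K -> ~~ btie r (J :|: K) gam u v.
  by move=> uJ vK; apply: nbt => //; apply: sep.
have gsep' u v : u \in K -> v \in J -> ~~ btie r (K :|: J) gam u v.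
  by move=> uK vJ; rewrite setUC btie_sym gsep.
rewrite properE; apply/andP; split.
  apply/subsetP => -[u v]; rewrite !inE /=; apply: contra => uv.
  have /and3P[uU vU /orP[uvl|uvt]] := uv; first by rewrite /linked uU vU uvl.
  rewrite /linked uU vU; apply/orP; right; rewrite -UE in uvt uU vU.
  case/setUP: uU => uL; case/setUP: vU => vL.
  + apply: (btie_subset JU); rewrite (siso_btie zJ) //.
    exact: btie_setU gsep _ _ uvt.
  + by rewrite (negPf (gsep _ _ uL vL)) in uvt.
  + by rewrite btie_sym (negPf (gsep _ _ vL uL)) in uvt.
  + apply: (btie_subset KU); rewrite (siso_btie zK) //; rewrite setUC in uvt.
    exact: btie_setU gsep' _ _ uvt.
apply/subsetPn.
have [/existsP[u /existsP[v /and3P[uJ vK uv]]]|no] :=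
    boolP [exists u, exists v, [&& u \in J, v \in K & linked r U (pt z) u v]].
  by exists (u, v); rewrite !inE /= ?uv ?sep.
case: nzU; rewrite -UE; apply: siso_glue => // u v uJ vK; apply: nbt => //.
apply: contra no => uv; apply/existsP; exists u; apply/existsP; exists v.
by rewrite uJ vK.
Qed.

End Types.

(** * Locality is preserved by counting *)

Section Locality.
Variables (S : finType) (sar : S -> nat).
Implicit Types (A B C : structure sar) (V W : finType).

(** The result type covers truth values, integers and cardinalities. The index type [V] is arbitrary
    so that a quantifier over [m] points can enlarge it to [V + 'I_m]. *)
Definition weakly_local (T : Type) r (ev : forall A, (nat -> A) -> T)
    (fv : pred nat) : Prop :=
  forall A B V (p : V -> A) (q : V -> B) (beta : nat -> A) (beta' : nat -> B),
    weak_equiv r p q ->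
    (forall x, fv x -> exists2 v, beta x = p v & beta' x = q v) ->
    ev A beta = ev B beta'.

(** The value of [ev] after binding depends only on the [r]-sphere type of the extended family, and
    each type has equally many realizers in [A] and in [B]. *)
Lemma weakly_local_count r n ys (ev : forall A, (nat -> A) -> bool) (fv : pred nat) :
  weakly_local r ev fv -> size ys * (2 * r).+1 + r <= n ->
  weakly_local n
    (fun A beta => #|[set u : (size ys).-tuple A | ev A (supds beta u)]|)
    (fun x => (x \notin ys) && fv x).
Proof.
move=> loc le A B V p q beta beta' pq fvP.
pose Phi (z : (size ys).-tuple A + (size ys).-tuple B) :=
  match z with inl c => ev A (supds beta c) | inr d => ev B (supds beta' d) end.
have := @card_siso_invariant _ _ _ _ _ _ r setT p q Phi.
apply=> [z z' zz'|z _]; last exact: card_realizers pq le.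
have rn : r <= n by apply: leq_trans le; apply: leq_addl.
have [_ gAB] := weak_equiv_mono rn pq.
have [_ gBA] := weak_equiv_sym (weak_equiv_mono rn pq).
(* Two tuples may also lie in the same structure; the identity then serves as the bijection. *)
have gid C : exists g : C -> C, bijective g /\
    forall x, siso r [set: unit] (fun=> x) (fun=> g x).
  by exists id; split=> [|x]; [exists id | apply: siso_refl].
have val C (s : V -> C) (b : nat -> C) (c : (size ys).-tuple C) x :
    (x \in ys -> exists2 i : 'I_(size ys), index x ys = i
       & supds b c x = extend s c (inr i)) /\
    (x \notin ys -> supds b c x = b x).
  rewrite /supds; case: ifP => // xys; split=> // _.
  have lt : index x ys < size ys by rewrite index_mem.
  by exists (Ordinal lt); rewrite //= (tnth_nth (b x)).
have step C C' (s : V -> C) (s' : V -> C') b b' (c : (size ys).-tuple C)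
    (c' : (size ys).-tuple C') :
    (exists g : C -> C', bijective g /\
       forall x, siso r [set: unit] (fun=> x) (fun=> g x)) ->
    (forall x, (x \notin ys) && fv x -> exists2 v, b x = s v & b' x = s' v) ->
    siso r setT (extend s c) (extend s' c') ->
    ev C (supds b c) -> ev C' (supds b' c').
  move=> g bP cc'; rewrite (loc _ _ _ (extend s c) (extend s' c') _ (supds b' c')) //.
  move=> x fx; have [v1 v2] := val _ s b c x; have [w1 w2] := val _ s' b' c' x.
  have [xys|nxys] := boolP (x \in ys).
    have [i e ->] := v1 xys; have [j e' ->] := w1 xys.
    by exists (inr i) => //; congr (extend _ _ (inr _)); apply: val_inj; rewrite /= -e -e'.
  by have [|v e e'] := bP x; rewrite ?nxys //; exists (inl v); rewrite ?v2 ?w2.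
case: z z' zz' => [c|c] [d|d] /= cd.
- by apply: step cd => // x /fvP[v]; exists v.
- by apply: step cd.
- by apply: step cd => // x /fvP[v]; exists v.
- by apply: step cd => // x /fvP[v]; exists v.
Qed.

End Locality.

(** * Induction on formulas and counting terms *)

Section Formulas.
Variables (S : finType) (sar : S -> nat) (P : countType) (par : P -> nat).
Variable sem : forall p : P, (par p).-tuple int -> Prop.

Scheme focn_mut := Induction for focn Sort Prop
  with cterm_mut := Induction for cterm Sort Prop.
Combined Scheme focn_cterm_ind from focn_mut, cterm_mut.

Definition hanf_radius w d := ((2 * w + 1) ^ d).-1.

Lemma hanf_radius_leq w d d' : d <= d' -> hanf_radius w d <= hanf_radius w d'.
Proof.
move=> dd'; rewrite /hanf_radius -ltnS !prednK ?expn_gt0 ?addn1 //.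
by rewrite leq_pexp2l.
Qed.

(** Writing [r] for the radius at depth [d], [m(2r+1) + r <= w(2r+2) + r = (2w+1)(r+1) - 1]. *)
Lemma hanf_radiusS w d m : m <= w ->
  m * (2 * hanf_radius w d).+1 + hanf_radius w d <= hanf_radius w d.+1.
Proof.
move=> mw; rewrite /hanf_radius expnS.
have: 0 < (2 * w + 1) ^ d by rewrite expn_gt0 addn1.
case: (_ ^ d) => // b _ /=; rewrite mulnDl mul1n addnS /= leq_add2r.
rewrite -mulnA mulnCA; apply: leq_mul => //.
by rewrite mulnS add2n ltnS leqnSn.
Qed.

(** The width bound [w] stays fixed through the induction and is positive to accommodate [FEx],
    which binds one point. Both sides share the number assignment [nu], so subformulas may have free
    number variables. *)
Lemma focn_weakly_local w : 0 < w ->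
  (forall f : focn sar par, wf_form f -> cwidth f <= w -> forall nu,
     weakly_local (hanf_radius w (br f))
       (fun A beta => @focn_eval _ sar _ par sem A beta nu f) (fun x => sfree x f)) /\
  (forall t : cterm sar par, wf_term t -> cwidth_t t <= w -> forall nu,
     weakly_local (hanf_radius w (br_t t))
       (fun A beta => @cterm_eval _ sar _ par sem A beta nu t) (fun x => sfree_t x t)).
Proof.
move=> w0; apply: focn_cterm_ind => /=.
- move=> x y _ _ nu A B V p q beta beta' [[f [[fi _ _] fe]] _] fvP.
  have [|v e e'] := fvP x; first by rewrite eqxx.
  have [|u e1 e1'] := fvP y; first by rewrite eqxx orbT.
  have pD a : p a \in ballU (hanf_radius w 0) setT p.
    by apply: ballU_within (within_refl _ _); rewrite ?inE.
  rewrite e e' e1 e1' -!fe ?inE //; apply/eqP/eqP => [->//|].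
  by apply: fi.
- move=> R xs _ _ nu A B V p q beta beta' [[f [[_ _ fr] fe]] _] fvP.
  have tP i : exists2 v, beta (xs i) = p v & beta' (xs i) = q v.
    by apply: fvP; apply/existsP; exists i.
  rewrite fr => [|i].
    congr (srel _ _ _); apply: eq_from_tnth => i; rewrite !tnth_map tnth_ord_tuple.
    by have [v -> ->] := tP i; rewrite fe ?inE.
  rewrite tnth_map tnth_ord_tuple; have [v -> _] := tP i.
  by apply: ballU_within (within_refl _ _); rewrite ?inE.
- move=> f IH wf cw nu A B V p q beta beta' pq fvP.
  by congr (~~ _); apply: IH pq fvP.
- move=> f IHf g IHg /andP[wf wg]; rewrite geq_max => /andP[cf cg] nu.
  move=> A B V p q beta beta' pq fvP; congr orb.
    apply: (IHf wf cf nu _ _ _ p q).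
      exact: weak_equiv_mono (hanf_radius_leq _ (leq_maxl _ _)) pq.
    by move=> x fx; apply: fvP; rewrite fx.
  apply: (IHg wg cg nu _ _ _ p q).
    exact: weak_equiv_mono (hanf_radius_leq _ (leq_maxr _ _)) pq.
  by move=> x fx; apply: fvP; rewrite fx orbT.
(* An existential quantifier asks whether the count over 1-tuples is positive. *)
- move=> y f IH wf cw nu A B V p q beta beta' pq fvP.
  have := @weakly_local_count _ _ _ _ [:: y] _ _ (IH wf cw nu) (hanf_radiusS _ w0).
  move=> /(_ _ _ _ _ _ _ _ pq) => /(_ beta beta') cnt.
  have exE (C : structure sar) (b : nat -> C) :
      [exists a : C, focn_eval sem (supd b y a) nu f] =
      (0 < #|[set u : (size [:: y]).-tuple C | focn_eval sem (supds b u) nu f]|).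
    have upd (u : 1.-tuple C) : @supds _ _ _ b [:: y] u = supd b y (tnth u ord0).
      apply: funext => z; rewrite /supds /supd inE; case: eqP => //= ->.
      by rewrite eqxx (tnth_nth (b y)).
    apply/existsP/card_gt0P => [[a fa]|[u]].
      by exists [tuple a]; rewrite inE upd.
    by rewrite inE upd; exists (tnth u ord0).
  rewrite !exE cnt // => x; rewrite inE => xf; exact: fvP.
- move=> p ts IH /forallP wf cw nu A B V s s' beta beta' pq fvP.
  congr (`[< sem _ >]); apply: eq_from_tnth => i; rewrite !tnth_map tnth_ord_tuple.
  have ci : cwidth_t (ts i) <= w by apply: leq_trans cw; apply: leq_bigmax.
  apply: (IH i (wf i) ci nu _ _ _ s s').
    by apply: weak_equiv_mono pq; apply: hanf_radius_leq; apply: leq_bigmax.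
  by move=> x xi; apply: fvP; apply/existsP; exists i.
(* Number quantifiers have the same range on both sides, because the bijection makes the universes
   equally large; the radius does not grow. *)
- move=> k f IH wf cw nu A B V p q beta beta' pq fvP.
  have cAB : #|A| = #|B| by have [_ [g [gb _]]] := pq; apply: bij_eq_card gb.
  rewrite cAB; apply: eq_existsb => n; exact: IH pq fvP.
- move=> ys f IH /and3P[_ _ wf]; rewrite geq_max => /andP[cy cw] nu.
  move=> A B V p q beta beta' pq fvP; congr Posz.
  exact: (weakly_local_count (IH wf cw nu) (hanf_radiusS _ cy) pq).
- by [].
- move=> s IHs t IHt /andP[wf wg]; rewrite geq_max => /andP[cf cg] nu.
  move=> A B V p q beta beta' pq fvP; congr (_ + _)%R.
    apply: (IHs wf cf nu _ _ _ p q).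
      exact: weak_equiv_mono (hanf_radius_leq _ (leq_maxl _ _)) pq.
    by move=> x fx; apply: fvP; rewrite fx.
  apply: (IHt wg cg nu _ _ _ p q).
    exact: weak_equiv_mono (hanf_radius_leq _ (leq_maxr _ _)) pq.
  by move=> x fx; apply: fvP; rewrite fx orbT.
- move=> s IHs t IHt /andP[wf wg]; rewrite geq_max => /andP[cf cg] nu.
  move=> A B V p q beta beta' pq fvP; congr (_ * _)%R.
    apply: (IHs wf cf nu _ _ _ p q).
      exact: weak_equiv_mono (hanf_radius_leq _ (leq_maxl _ _)) pq.
    by move=> x fx; apply: fvP; rewrite fx.
  apply: (IHt wg cg nu _ _ _ p q).
    exact: weak_equiv_mono (hanf_radius_leq _ (leq_maxr _ _)) pq.
  by move=> x fx; apply: fvP; rewrite fx orbT.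
- by [].
Qed.

(** Links the case distinction in [bw] to [cwidth]. Well-formedness enters because a counting term
    over an empty tuple could have width 0. *)
Lemma cwidth_br_spec :
  (forall f : focn sar par, wf_form f ->
     [/\ has_count f = (0 < cwidth f)
       & ~~ has_count f -> ~~ has_sex f -> br f = 0]) /\
  (forall t : cterm sar par, wf_term t ->
     [/\ has_count_t t = (0 < cwidth_t t)
       & ~~ has_count_t t -> ~~ has_sex_t t -> br_t t = 0]).
Proof.
apply: focn_cterm_ind => //=.
- move=> f IHf g IHg /andP[/IHf[-> bf] /IHg[-> bg]]; rewrite leq_max.
  split=> //; rewrite !negb_or => /andP[nf ng] /andP[sf sg].
  by rewrite bf // bg.
- by move=> y f IH /IH[-> _]; split.
- move=> p ts IH /forallP wf; split.
    apply/existsP/idP => [[i]|].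
      by case: (IH i (wf i)) => -> _ h; apply: leq_trans h (leq_bigmax i).
    case: (pickP (fun i => 0 < cwidth_t (ts i))) => [i h _|no].
      by exists i; case: (IH i (wf i)) => ->.
    by rewrite big1 // => i _; have := no i; case: cwidth_t.
  move=> /existsPn nc /existsPn ns; rewrite big1 // => i _.
  by case: (IH i (wf i)) => _; apply; [apply: nc|apply: ns].
- by move=> ys f _ /and3P[ys0 _ _]; split=> //; rewrite leq_max lt0n size_eq0 ys0.
- move=> s IHs t IHt /andP[/IHs[-> bs] /IHt[-> bt]]; rewrite leq_max.
  split=> //; rewrite !negb_or => /andP[ns nt] /andP[ss st].
  by rewrite bs // bt.
- move=> s IHs t IHt /andP[/IHs[-> bs] /IHt[-> bt]]; rewrite leq_max.
  split=> //; rewrite !negb_or => /andP[ns nt] /andP[ss st].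
  by rewrite bs // bt.
Qed.

End Formulas.

(** * From r-equivalence to the bound on the rank *)

(** Restrict the isomorphism of the spheres of [(a, c)] and [(b, g c)] to the first [k] points or to
    the last one. *)
Lemma r_equiv_weak (S : finType) (sar : S -> nat) (A B : structure sar) r k
    (a : k.-tuple A) (b : k.-tuple B) :
  r_equiv r a b -> weak_equiv r (tnth a) (tnth b).
Proof.
move=> [g [gb gs]].
have snoc_siso c : siso r setT (tnth (snoc_tuple a c)) (tnth (snoc_tuple b (g c))).
  have nE (D : structure sar) (s : (k + 1).-tuple D) : nbhd r s = ballU r setT (tnth s).
    apply/setP => x; rewrite !inE; apply/existsP/exists_inP => [[i]|[i _]]; by exists i.
  have [f [fi fE fe fr]] := gs c; exists f; split=> [|i _]; last exact: fe.
  by rewrite -!nE; split.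
have tl (D : structure sar) (s : k.-tuple D) x :
    tnth s =1 tnth (snoc_tuple s x) \o lshift 1.
  move=> i; rewrite /= !(tnth_nth x) /= nth_cat size_tuple.
  by rewrite (_ : (i < k) = true) //; apply: ltn_ord.
have tr (D : structure sar) (s : k.-tuple D) x :
    (fun _ : unit => x) =1 tnth (snoc_tuple s x) \o (fun=> rshift k ord0).
  by move=> i; rewrite /= (tnth_nth x) /= nth_cat size_tuple ltnNge leq_addr /= addKn.
split.
  (* Any last point would do; one exists since the universe is non-empty. *)
  have := siso_reindex (J := setT) (h := lshift 1) (leqnn r) _ (snoc_siso (elt0 A)).
  by move=> /(_ (fun _ _ => in_setT _)); apply: eq_siso => i _; rewrite -tl.
exists g; split=> // x.
have := siso_reindex (J := [set: unit]) (h := fun=> rshift k ord0) (leqnn r) _ (snoc_siso x).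
by move=> /(_ (fun _ _ => in_setT _)); apply: eq_siso => i _; rewrite -tr.
Qed.

Theorem corollary5p3
  (P : countType) (par : P -> nat) (par_pos : forall p : P, 0 < par p)
  (sem : forall p : P, (par p).-tuple int -> Prop)
  (S : finType) (sar : S -> nat)
  (phi : focn sar par) (k : nat) (xs : k.-tuple nat) :
  wf_form phi ->
  uniq xs ->
  (forall x, sfree x phi -> x \in xs) ->
  (forall kappa, ~~ nfree kappa phi) ->
  exists r : nat,
    r < (2 * bw phi + 1) ^ br phi /\ hanf_local_at sem xs phi r.
Proof.
move=> wf _ fvP _.
have local w : 0 < w -> cwidth phi <= w ->
    hanf_local_at sem xs phi (hanf_radius w (br phi)).
  move=> w0 cw A B a b /r_equiv_weak ab.
  have [loc _] := @focn_weakly_local S sar P par sem w w0.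
  suff -> : focn_sat sem xs a phi = focn_sat sem xs b phi by [].
  apply: (loc _ wf cw _ _ _ _ _ _ _ _ ab).
  move=> x /fvP xx; have lt : index x xs < k by rewrite -{2}(size_tuple xs) index_mem.
  exists (Ordinal lt); first by rewrite xx (tnth_nth (elt0 A)).
  by rewrite xx (tnth_nth (elt0 B)).
have lt w d : hanf_radius w d < (2 * w + 1) ^ d.
  by rewrite /hanf_radius prednK // expn_gt0 addn1.
have [hc br0] := proj1 (@cwidth_br_spec S sar P par) _ wf.
rewrite /bw; case: ifP hc br0 => [_ cw _|_ cw br0].
  by exists (hanf_radius (cwidth phi) (br phi)); split; [|apply: local].
have c0 : cwidth phi <= 1 by case: (cwidth phi) cw.
(* Without counting terms the width 1 is used. If no structure quantifier occurs either, [bw] is 0,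
   but then the binding rank is 0 and the radius 0 lies below the bound 1. *)
exists (hanf_radius 1 (br phi)); split; last exact: local.
by case: ifP br0 => [_ _|_ ->].
Qed.
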